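(* Consider the system of differential equations $$\dot p=-rq,\quad \dot q=-rp-\gamma_3,\quad \dot r=-2q(2p+1)-2\gamma_2,$$ $$\dot\gamma_1=2(q\gamma_3-r\gamma_2),\quad \dot\gamma_2=2(p\gamma_3-r\gamma_1),\quad \dot\gamma_3=2(p^2-q^2)q-2q\gamma_1+2p\gamma_2,$$ with the first-integral constants $g_2,g_3,k$ (and $h=0$), the variables $x_1,x_2$ and the polynomials $P,\mathcal F$ given in the context. This system is integrated through the solutions of the system $$\frac{ds_1}{\sqrt{\Phi(s_1)}}+\frac{ds_2}{\sqrt{\Phi(s_2)}}=0,\qquad \frac{s_1\,ds_1}{\sqrt{\Phi(s_1)}}+\frac{s_2\,ds_2}{\sqrt{\Phi(s_2)}}=2\,dt,$$ where $\Phi(s)=P(s)(s-k)(s+k)$ and $s_1,s_2$ are the roots of $\mathcal F(x_1,x_2,s)=0$ in $s$; that is, along the solutions $s_1,s_2$ satisfy these relations (for suitable branches of the square roots).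
   Context: Put $x_1=p+q$, $x_2=p-q$, $e_1=x_1^2+\gamma_1+\gamma_2$, $e_2=x_2^2+\gamma_1-\gamma_2$. The system has first integrals, with constants $h,g_2,g_3,k$, given by $$r^2=2(x_1+x_2)+e_1+e_2+h,\quad r\gamma_3=-x_1x_2-x_2e_1-x_1e_2-\tfrac{g_2}{4},\quad \gamma_3^2=x_2^2e_1+x_1^2e_2-\tfrac{g_3}{2},\quad e_1e_2=k^2.$$ The normalization $h=0$ is assumed. The polynomials are $$P(x)=2x^3-\tfrac{g_2}{2}x-\tfrac{g_3}{2},$$ $$\mathcal F(x_1,x_2,s)=(x_1-x_2)^2s^2+\Big(-2x_1x_2(x_1+x_2)+\tfrac{g_2}{2}(x_1+x_2)+g_3\Big)s+x_1^2x_2^2+x_1x_2\tfrac{g_2}{2}+g_3(x_1+x_2)+\tfrac{g_2^2}{16}.$$ *)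

(* Defs.v *)
From Stdlib Require Export Reals.
From Coquelicot Require Export Coquelicot.
Open Scope C_scope.

(* Derivative of a complex-valued function of the real variable t;
   C is viewed as a real normed module. *)
Definition is_deriv (f : R -> C) (t : R) (l : C) : Prop :=
  @is_derive R_AbsRing C_R_NormedModule f t l.

Definition is_solution (a b : Rbar) (p q r gam1 gam2 gam3 : R -> C) : Prop :=
  forall t : R, Rbar_lt a t -> Rbar_lt t b ->
    is_deriv p t (- (r t * q t)) /\
    is_deriv q t (- (r t * p t) - gam3 t) /\
    is_deriv r t (- (2 * q t * (2 * p t + 1)) - 2 * gam2 t) /\
    is_deriv gam1 t (2 * (q t * gam3 t - r t * gam2 t)) /\
    is_deriv gam2 t (2 * (p t * gam3 t - r t * gam1 t)) /\
    is_deriv gam3 t (2 * ((p t) ^ 2 - (q t) ^ 2) * q t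
                     - 2 * q t * gam1 t + 2 * p t * gam2 t).

Definition on_level (h g2 g3 k p q r gam1 gam2 gam3 : C) : Prop :=
  let x1 := p + q in
  let x2 := p - q in
  let e1 := x1 ^ 2 + gam1 + gam2 in
  let e2 := x2 ^ 2 + gam1 - gam2 in
  r ^ 2 = 2 * (x1 + x2) + e1 + e2 + h /\
  r * gam3 = - (x1 * x2) - x2 * e1 - x1 * e2 - g2 / 4 /\
  gam3 ^ 2 = x2 ^ 2 * e1 + x1 ^ 2 * e2 - g3 / 2 /\
  e1 * e2 = k ^ 2.

Definition polyP (g2 g3 x : C) : C :=
  2 * x ^ 3 - g2 / 2 * x - g3 / 2.

Definition polyF (g2 g3 x1 x2 s : C) : C :=
  (x1 - x2) ^ 2 * s ^ 2
  + (- (2 * x1 * x2 * (x1 + x2)) + g2 / 2 * (x1 + x2) + g3) * s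
  + (x1 ^ 2 * x2 ^ 2 + x1 * x2 * (g2 / 2) + g3 * (x1 + x2) + g2 ^ 2 / 16).

Definition polyPhi (g2 g3 k s : C) : C :=
  polyP g2 g3 s * (s - k) * (s + k).

(* s1, s2 are continuous branches, over the time set D, of the two roots of
   polyF (x1, x2, s) in s.  The last four conditions express that the quadratic
   in s is genuine, that its roots are distinct, and that the differentials
   ds_i / sqrt (Phi s_i) are defined (Coquelicot's division is total). *)
Definition root_branches (D : R -> Prop) (g2 g3 k : C)
    (x1 x2 s1 s2 : R -> C) : Prop :=
  forall t : R, D t ->
    continuous s1 t /\ continuous s2 t /\
    polyF g2 g3 (x1 t) (x2 t) (s1 t) = 0 /\
    polyF g2 g3 (x1 t) (x2 t) (s2 t) = 0 /\
    x1 t <> x2 t /\ s1 t <> s2 t /\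
    polyPhi g2 g3 k (s1 t) <> 0 /\ polyPhi g2 g3 k (s2 t) <> 0.

(* w1, w2 are continuous branches of sqrt (Phi s1) and sqrt (Phi s2). *)
Definition satisfies_quadratures (D : R -> Prop) (g2 g3 k : C)
    (s1 s2 : R -> C) : Prop :=
  exists ds1 ds2 w1 w2 : R -> C, forall t : R, D t ->
    is_deriv s1 t (ds1 t) /\ is_deriv s2 t (ds2 t) /\
    continuous w1 t /\ continuous w2 t /\
    (w1 t) ^ 2 = polyPhi g2 g3 k (s1 t) /\
    (w2 t) ^ 2 = polyPhi g2 g3 k (s2 t) /\
    ds1 t / w1 t + ds2 t / w2 t = 0 /\
    s1 t * ds1 t / w1 t + s2 t * ds2 t / w2 t = 2.

(* Main.v *)
(** The first integrals persist along the solution and, writing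
    R(x1,x2) = x1 x2 (x1+x2) - g2/4 (x1+x2) - g3/2, they give
    x1'^2 = P(x1) + (x1-x2)^2 e1, x2'^2 = P(x2) + (x1-x2)^2 e2 and
    x1' x2' = - R(x1,x2).  The biquadratic F satisfies, modulo F = 0,
    F_{x1}^2 = 4 P(s) P(x2), F_{x2}^2 = 4 P(s) P(x1), F_s^2 = 4 P(x1) P(x2) and
    F_{x1} F_{x2} = - 2 P(s) F_s.  Hence N = F_{x1} x1' + F_{x2} x2', which is
    - F_s s' on a root s of F, satisfies N^2 = 4 (x1-x2)^4 Phi(s).  Since
    F_s = (x1-x2)^2 (s_i - s_j) at s = s_i, the functions
    w_i = - N(s_i) / (2 (x1-x2)^2) are square roots of Phi(s_i) with
    s_i' / w_i = 2 / (s_i - s_j), and both relations follow. *)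

Require Import Defs.
From Stdlib Require Import Reals Lra.
From Coquelicot Require Import Coquelicot.
Open Scope C_scope.

(** * Continuity of complex functions of a real variable *)

Lemma continuous_C (f : R -> C) (t : R) :
  continuous f t <->
  continuous (fun y => Re (f y)) t /\ continuous (fun y => Im (f y)) t.
Proof.
  split.
  - intros Hf; split; apply (continuous_comp f _ t Hf); destruct (f t) as [u v].
    + apply continuous_fst.
    + apply continuous_snd.
  - intros [Hre Him].
    apply continuous_ext with (fun y => (Re (f y), Im (f y))).
    { intros y; symmetry; apply surjective_pairing. }
    apply (continuous_comp_2 _ _ (fun u v : R => (u, v)) t Hre Him).
    apply continuous_ext with (fun z => z); [intros z; apply surjective_pairing|].
    apply continuous_id.
Qed.

Lemma continuous_Cplus (f g : R -> C) (t : R) :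
  continuous f t -> continuous g t -> continuous (fun y => f y + g y) t.
Proof. exact (@continuous_plus _ _ C_R_NormedModule f g t). Qed.

Lemma continuous_Copp (f : R -> C) (t : R) :
  continuous f t -> continuous (fun y => - f y) t.
Proof. exact (@continuous_opp _ _ C_R_NormedModule f t). Qed.

Lemma continuous_Cmult (f g : R -> C) (t : R) :
  continuous f t -> continuous g t -> continuous (fun y => f y * g y) t.
Proof.
  intros [Hf1 Hf2]%continuous_C [Hg1 Hg2]%continuous_C.
  apply continuous_C; split; simpl.
  - apply (continuous_minus (V := R_NormedModule));
      apply (continuous_mult (K := R_AbsRing)); assumption.
  - apply (continuous_plus (V := R_NormedModule));
      apply (continuous_mult (K := R_AbsRing)); assumption.
Qed.

Lemma continuous_Cinv (f : R -> C) (t : R) :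
  continuous f t -> f t <> 0 -> continuous (fun y => / f y) t.
Proof.
  intros [Hf1 Hf2]%continuous_C Hnz.
  assert (Hn : (Re (f t) ^ 2 + Im (f t) ^ 2 <> 0)%R).
  { intros E; apply Hnz, injective_projections; simpl; unfold Re, Im in E; nra. }
  assert (Hsq : forall u : R -> R, continuous u t -> continuous (fun y => u y ^ 2)%R t).
  { intros u Hu. apply (continuous_mult (K := R_AbsRing) u (fun y => u y * 1)%R); [exact Hu|].
    apply (continuous_mult (K := R_AbsRing) u (fun _ => 1)%R); [exact Hu|].
    apply continuous_const. }
  assert (Hc : continuous (fun y => / (Re (f y) ^ 2 + Im (f y) ^ 2))%R t).
  { apply continuous_Rinv_comp; [|exact Hn].
    apply (continuous_plus (V := R_NormedModule)
             (fun y => Re (f y) ^ 2)%R (fun y => Im (f y) ^ 2)%R);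
      apply Hsq; assumption. }
  apply continuous_C; split; apply (continuous_mult (K := R_AbsRing)); try assumption.
  apply (continuous_opp (V := R_NormedModule)); assumption.
Qed.

(** * Differentiation of complex functions of a real variable *)

(** Carathéodory's criterion trades the little-o estimate for continuity of a slope function [phi].
    The product rule and the differentiability of a root of a quadratic then reduce to algebra on
    slopes. *)
Lemma is_deriv_caratheodory (f : R -> C) (t : R) (l : C) :
  is_deriv f t l <->
  exists phi : R -> C,
    continuous phi t /\ phi t = l /\
    locally t (fun y => f y = f t + RtoC (y - t) * phi y).
Proof.
  assert (Hs : forall (x : R) (z : C), @scal _ C_R_ModuleSpace x z = RtoC x * z)
    by apply scal_R_Cmult.
  split.
  - intros [_ Hd].
    exists (fun y => match Req_EM_T y t with
             | left _ => l
             | right _ => (f y - f t) / RtoC (y - t)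
             end).
    assert (Ht : forall P Q : C, (if Req_EM_T t t then P else Q) = P)
      by (intros; destruct (Req_EM_T t t); congruence).
    split; [|split].
    + apply (filterlim_locally_ball_norm (U := C_R_NormedModule)); intros eps.
      rewrite Ht.
      (* The little-o bound is a weak inequality while the ball is open, hence half of [eps]. *)
      assert (He : (0 < eps / 2)%R) by (destruct eps; simpl; lra).
      specialize (Hd t (fun P H => H) (mkposreal _ He)). simpl in Hd.
      revert Hd; apply filter_imp; intros y Hy.
      destruct (Req_EM_T y t) as [E|E];
        [apply (ball_norm_center (V := C_R_NormedModule) l eps)|].
      assert (Hyt : (y - t <> 0)%R) by lra.
      assert (Hyt' : RtoC (y - t) <> 0) by (intros E'; apply Hyt, RtoC_inj, E').
      unfold ball_norm.
      change (@minus C_R_NormedModule) with Cminus in *.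
      replace ((f y - f t) / RtoC (y - t) - l)
        with (@scal _ C_R_ModuleSpace (/ (y - t))%R
                (f y - f t - @scal _ C_R_ModuleSpace (y - t)%R l)).
      2:{ rewrite !Hs, RtoC_inv by exact Hyt.
          match goal with |- ?u = ?v => change (@eq C u v) end. field. exact Hyt'. }
      eapply Rle_lt_trans; [apply (norm_scal (V := C_R_NormedModule))|].
      eapply Rle_lt_trans.
      { apply Rmult_le_compat_l; [apply abs_ge_0|exact Hy]. }
      change (Rabs (/ (y - t)) * (eps / 2 * Rabs (y - t)) < eps)%R.
      rewrite Rabs_inv.
      assert (0 < Rabs (y - t))%R by (apply Rabs_pos_lt; lra).
      replace (/ Rabs (y - t) * (eps / 2 * Rabs (y - t)))%R with (eps / 2)%R by (field; lra).
      destruct eps; simpl; lra.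
    + apply Ht.
    + apply filter_forall; intros y. destruct (Req_EM_T y t) as [->|E].
      * rewrite Rminus_diag. ring.
      * field. intros E'; apply E. apply RtoC_inj in E'. lra.
  - intros (phi & Hc & <- & Heq).
    split; [apply (is_linear_scal_l (V := C_R_NormedModule))|].
    intros x Hx. apply (is_filter_lim_locally_unique t) in Hx as <-.
    intros eps.
    apply (filterlim_locally_ball_norm (U := C_R_NormedModule)) with (eps := eps) in Hc.
    generalize (filter_and _ _ Heq Hc). apply filter_imp; intros y [Ey Hy].
    unfold ball_norm in Hy.
    change (@minus C_R_NormedModule) with Cminus in *.
    change (minus y t) with (y - t)%R.
    (* The error of the linear approximation is [y - t] times the variation of [phi], which is small
       by continuity. *)
    assert (E : (f y - f t - @scal _ C_R_ModuleSpace (y - t)%R (phi t))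
                = @scal _ C_R_ModuleSpace (y - t)%R (phi y - phi t))
      by (rewrite !Hs, Ey; ring).
    match goal with |- (norm ?x <= _)%R =>
      change x with (f y - f t - @scal _ C_R_ModuleSpace (y - t)%R (phi t)) end.
    rewrite E.
    eapply Rle_trans; [apply (norm_scal (V := C_R_NormedModule))|].
    rewrite Rmult_comm. apply Rmult_le_compat_r; [apply abs_ge_0|].
    apply Rlt_le, Hy.
Qed.

Lemma is_deriv_continuous (f : R -> C) (t : R) (l : C) :
  is_deriv f t l -> continuous f t.
Proof. intros H. apply (ex_derive_continuous (V := C_R_NormedModule)). now exists l. Qed.

Lemma is_deriv_Cmult (f g : R -> C) (t : R) (df dg : C) :
  is_deriv f t df -> is_deriv g t dg ->
  is_deriv (fun y => f y * g y) t (df * g t + f t * dg).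
Proof.
  intros Hf Hg. pose proof (is_deriv_continuous _ _ _ Hg) as Cg.
  apply is_deriv_caratheodory in Hf as (phi & Cphi & <- & Ephi).
  apply is_deriv_caratheodory in Hg as (psi & Cpsi & <- & Epsi).
  apply is_deriv_caratheodory.
  (* Slope read off from f(y)g(y) - f(t)g(t) = (f(y) - f(t)) g(y) + f(t) (g(y) - g(t)). *)
  exists (fun y => phi y * g y + f t * psi y).
  split; [|split; [reflexivity|]].
  - apply continuous_Cplus; apply continuous_Cmult; auto. apply continuous_const.
  - generalize (filter_and _ _ Ephi Epsi). apply filter_imp.
    intros y [E1 E2]. rewrite E1, E2. ring.
Qed.

Lemma continuous_Cneq (f : R -> C) (t : R) :
  continuous f t -> f t <> 0 -> locally t (fun y => f y <> 0).
Proof.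
  intros [Hre Him]%continuous_C Hnz.
  destruct (Req_dec (Re (f t)) 0) as [E|E].
  - assert (E' : Im (f t) <> 0%R)
      by (intros E'; apply Hnz, injective_projections; assumption).
    generalize (Him _ (open_neq 0 _ E') : locally t (fun y => Im (f y) <> 0%R)).
    apply filter_imp.
    intros y Hy H. apply Hy. now rewrite H.
  - generalize (Hre _ (open_neq 0 _ E) : locally t (fun y => Re (f y) <> 0%R)).
    apply filter_imp.
    intros y Hy H. apply Hy. now rewrite H.
Qed.

Lemma is_deriv_eq (f : R -> C) (t : R) (l l' : C) :
  is_deriv f t l -> l = l' -> is_deriv f t l'.
Proof. now intros H <-. Qed.

Lemma is_deriv_const (c : C) (t : R) : is_deriv (fun _ => c) t 0.
Proof. exact (is_derive_const (V := C_R_NormedModule) c t). Qed.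

Lemma is_deriv_Cplus (f g : R -> C) (t : R) (df dg : C) :
  is_deriv f t df -> is_deriv g t dg -> is_deriv (fun y => f y + g y) t (df + dg).
Proof. exact (is_derive_plus (V := C_R_NormedModule) f g t df dg). Qed.

Lemma is_deriv_Copp (f : R -> C) (t : R) (df : C) :
  is_deriv f t df -> is_deriv (fun y => - f y) t (- df).
Proof. exact (is_derive_opp (V := C_R_NormedModule) f t df). Qed.

Lemma is_deriv_Cminus (f g : R -> C) (t : R) (df dg : C) :
  is_deriv f t df -> is_deriv g t dg -> is_deriv (fun y => f y - g y) t (df - dg).
Proof. exact (is_derive_minus (V := C_R_NormedModule) f g t df dg). Qed.

Lemma is_deriv_Csqr (f : R -> C) (t : R) (df : C) :
  is_deriv f t df -> is_deriv (fun y => f y ^ 2) t (2 * f t * df).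
Proof.
  intros Hf.
  eapply is_deriv_eq.
  - apply (is_deriv_Cmult f (fun y => f y * 1)); [exact Hf|].
    apply (is_deriv_Cmult f (fun _ => 1)); [exact Hf|apply is_deriv_const].
  - simpl. ring.
Qed.

Lemma is_deriv_Cdiv_const (f : R -> C) (c : C) (t : R) (df : C) :
  is_deriv f t df -> is_deriv (fun y => f y / c) t (df / c).
Proof.
  intros Hf.
  eapply is_deriv_eq.
  - apply (is_deriv_Cmult f (fun _ => / c)); [exact Hf|apply is_deriv_const].
  - unfold Cdiv; ring.
Qed.

(** Builds the derivative by the rules above, taking the leaves from the context. Used under
    [is_deriv_eq] with the derivative left open, it reduces the goal to an algebraic identity. *)
Ltac solve_deriv :=
  lazymatch goal with
  | |- is_deriv (fun _ => ?c) _ _ => apply is_deriv_const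
  | |- is_deriv (fun y => @?f y - @?g y) _ _ => eapply (is_deriv_Cminus f g); solve_deriv
  | |- is_deriv (fun y => @?f y + @?g y) _ _ => eapply (is_deriv_Cplus f g); solve_deriv
  | |- is_deriv (fun y => - @?f y) _ _ => eapply (is_deriv_Copp f); solve_deriv
  | |- is_deriv (fun y => @?f y / ?c) _ _ => eapply (is_deriv_Cdiv_const f c); solve_deriv
  | |- is_deriv (fun y => @?f y * @?g y) _ _ => eapply (is_deriv_Cmult f g); solve_deriv
  | |- is_deriv (fun y => (@?f y) ^ 2) _ _ => eapply (is_deriv_Csqr f); solve_deriv
  | |- _ => eassumption
  end.

(* Only continuity of [s] is assumed: with G(y) = A(y) (s(y) + s(t)) + B(y),
   (s(y) - s(t)) G(y) equals minus the quadratic at time y evaluated at s(t),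
   and G(t) is its derivative in s, so differentiability of [s] follows. *)
Lemma is_deriv_quadratic_root (A B K s : R -> C) (t : R) (dA dB dK : C) :
  is_deriv A t dA -> is_deriv B t dB -> is_deriv K t dK ->
  continuous s t ->
  locally t (fun y => A y * s y ^ 2 + B y * s y + K y = 0) ->
  2 * A t * s t + B t <> 0 ->
  is_deriv s t (- (dA * s t ^ 2 + dB * s t + dK) / (2 * A t * s t + B t)).
Proof.
  intros HA HB HC Hs Heq Hnz.
  pose (G y := A y * (s y + s t) + B y).
  assert (HG : continuous G t).
  { apply continuous_Cplus; [apply continuous_Cmult|];
      try (eapply is_deriv_continuous; eassumption).
    apply continuous_Cplus; [assumption|apply continuous_const]. }
  assert (EG : G t = 2 * A t * s t + B t) by (unfold G; ring).
  assert (HH : is_deriv (fun y => A y * s t ^ 2 + B y * s t + K y) t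
                 (dA * s t ^ 2 + dB * s t + dK)).
  { eapply is_deriv_eq; [solve_deriv|ring]. }
  apply is_deriv_caratheodory in HH as (phi & Cphi & Ephi & Hphi).
  apply is_deriv_caratheodory.
  exists (fun y => - phi y / G y). split; [|split].
  - apply continuous_Cmult; [now apply continuous_Copp|].
    apply continuous_Cinv; [assumption|]. now rewrite EG.
  - now rewrite Ephi, EG.
  - assert (HGnz : locally t (fun y => G y <> 0)).
    { apply continuous_Cneq; [exact HG|now rewrite EG]. }
    pose proof (locally_singleton _ _ Heq) as Et.
    generalize (filter_and _ _ Hphi (filter_and _ _ Heq HGnz)). apply filter_imp.
    intros y (E1 & E2 & Hy). rewrite Et in E1.
    assert (E3 : (s y - s t) * G y = - (RtoC (y - t) * phi y)).
    { transitivity ((A y * s y ^ 2 + B y * s y + K y) - (A y * s t ^ 2 + B y * s t + K y)).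
      - unfold G; ring.
      - rewrite E1, E2; ring. }
    transitivity (s t + (s y - s t) * G y / G y); [field; assumption|].
    rewrite E3. field; assumption.
Qed.

(** * Algebra of the biquadratic [polyF] on a level of the first integrals *)

(* The derivative of [polyF g2 g3 x1 x2 s] along [(dx1, dx2)] with [s] held fixed. *)
Definition polyF_deriv (g2 g3 x1 x2 dx1 dx2 s : C) : C :=
  2 * (x1 - x2) * (dx1 - dx2) * s ^ 2
  + (- (2 * (dx1 * x2 + x1 * dx2) * (x1 + x2) + 2 * x1 * x2 * (dx1 + dx2))
     + g2 / 2 * (dx1 + dx2)) * s
  + (2 * x1 * x2 * (dx1 * x2 + x1 * dx2) + (dx1 * x2 + x1 * dx2) * (g2 / 2)
     + g3 * (dx1 + dx2)).

(* The cofactors of [polyF] in the steps below are what the header's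
   congruences modulo F leave out. *)
Lemma polyF_deriv_sqr (g2 g3 k x1 x2 e1 e2 r c s : C) :
  r ^ 2 = 2 * (x1 + x2) + e1 + e2 ->
  r * c = - (x1 * x2) - x2 * e1 - x1 * e2 - g2 / 4 ->
  c ^ 2 = x2 ^ 2 * e1 + x1 ^ 2 * e2 - g3 / 2 ->
  e1 * e2 = k ^ 2 ->
  polyF g2 g3 x1 x2 s = 0 ->
  polyF_deriv g2 g3 x1 x2 (- (r * x1) - c) (r * x2 + c) s ^ 2
  = 4 * (x1 - x2) ^ 4 * polyPhi g2 g3 k s.
Proof.
  intros Hr Hrc Hc Hk HF.
  (* [y1], [y2] are the velocities of [x1], [x2] under the system with [c] in the role of gamma_3;
     [F1], [F2], [Fs] are the partial derivatives of [polyF] in [x1], [x2], [s]. *)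
  set (y1 := - (r * x1) - c). set (y2 := r * x2 + c).
  set (R0 := x1 * x2 * (x1 + x2) - g2 / 4 * (x1 + x2) - g3 / 2).
  set (F1 := 2 * (x1 - x2) * s ^ 2
    + (- (2 * x2 * (x1 + x2) + 2 * x1 * x2) + g2 / 2) * s
    + (2 * x1 * x2 ^ 2 + x2 * (g2 / 2) + g3)).
  set (F2 := - (2 * (x1 - x2)) * s ^ 2
    + (- (2 * x1 * (x1 + x2) + 2 * x1 * x2) + g2 / 2) * s
    + (2 * x1 ^ 2 * x2 + x1 * (g2 / 2) + g3)).
  set (Fs := 2 * ((x1 - x2) ^ 2 * s - R0)).
  set (d2 := (x1 - x2) ^ 2).
  set (P1 := polyP g2 g3 x1). set (P2 := polyP g2 g3 x2). set (Ps := polyP g2 g3 s).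
  assert (Ey1 : y1 ^ 2 = P1 + d2 * e1).
  { transitivity (r ^ 2 * x1 ^ 2 + 2 * x1 * (r * c) + c ^ 2); [unfold y1; ring|].
    rewrite Hr, Hrc, Hc. unfold P1, polyP, d2. field. }
  assert (Ey2 : y2 ^ 2 = P2 + d2 * e2).
  { transitivity (r ^ 2 * x2 ^ 2 + 2 * x2 * (r * c) + c ^ 2); [unfold y2; ring|].
    rewrite Hr, Hrc, Hc. unfold P2, polyP, d2. field. }
  assert (Ey12 : y1 * y2 = - R0).
  { transitivity (- (r ^ 2 * (x1 * x2) + (x1 + x2) * (r * c) + c ^ 2)); [unfold y1, y2; ring|].
    rewrite Hr, Hrc, Hc. unfold R0. field. }
  (* As a quadratic in [x1], [polyF] has leading coefficient [(s - x2) ^ 2], so this says that its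
     discriminant is 4 P(s) P(x2). Since [polyF] is symmetric in [x1], [x2], [s], [EF2] and [EP] are
     the same identity with the variables permuted. *)
  assert (EF1 : F1 ^ 2 = 4 * Ps * P2).
  { transitivity (4 * Ps * P2 + 4 * (s - x2) ^ 2 * polyF g2 g3 x1 x2 s).
    - unfold F1, Ps, P2, polyP, polyF. field.
    - rewrite HF; ring. }
  assert (EF2 : F2 ^ 2 = 4 * Ps * P1).
  { transitivity (4 * Ps * P1 + 4 * (s - x1) ^ 2 * polyF g2 g3 x1 x2 s).
    - unfold F2, Ps, P1, polyP, polyF. field.
    - rewrite HF; ring. }
  assert (EF12 : F1 * F2 = - (2 * Ps * Fs)).
  { transitivity (- (2 * Ps * Fs) + 4 * (s - x1) * (s - x2) * polyF g2 g3 x1 x2 s).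
    - unfold F1, F2, Ps, Fs, R0, polyP, polyF. field.
    - rewrite HF; ring. }
  assert (EP : P1 * P2 = (d2 * s - R0) ^ 2).
  { transitivity ((d2 * s - R0) ^ 2 - d2 * polyF g2 g3 x1 x2 s).
    - unfold P1, P2, R0, d2, polyP, polyF. field.
    - rewrite HF; ring. }
  (* Here the integral [e1 * e2 = k ^ 2] enters: [(y1 * y2) ^ 2] is computed once as [R0 ^ 2] and
     once as the product of [Ey1] and [Ey2]. *)
  assert (EX : d2 * (P2 * e1 + P1 * e2) = R0 ^ 2 - P1 * P2 - d2 ^ 2 * k ^ 2).
  { rewrite <- Hk. replace (R0 ^ 2) with (y1 ^ 2 * y2 ^ 2).
    - rewrite Ey1, Ey2. ring.
    - replace (y1 ^ 2 * y2 ^ 2) with ((y1 * y2) ^ 2) by ring. rewrite Ey12. ring. }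
  transitivity (F1 ^ 2 * y1 ^ 2 + F2 ^ 2 * y2 ^ 2 + 2 * (F1 * F2) * (y1 * y2)).
  { replace (polyF_deriv g2 g3 x1 x2 y1 y2 s) with (F1 * y1 + F2 * y2)
      by (unfold polyF_deriv, F1, F2; ring).
    ring. }
  rewrite EF1, EF2, EF12, Ey1, Ey2, Ey12.
  transitivity (4 * Ps * (2 * (P1 * P2) + d2 * (P2 * e1 + P1 * e2) + Fs * R0)); [ring|].
  (* With [Fs = 2 * (d2 * s - R0)], the terms [(d2 * s - R0) ^ 2 + R0 ^ 2 + Fs * R0] form the square
     of [d2 * s], and the bracket becomes [d2 ^ 2 * (s ^ 2 - k ^ 2)]. *)
  rewrite EX, EP. unfold polyPhi. fold Ps. fold d2 in Fs.
  replace ((x1 - x2) ^ 4) with (d2 ^ 2) by (unfold d2; ring).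
  unfold Fs. ring.
Qed.

Ltac solve_continuous :=
  lazymatch goal with
  | |- continuous (fun _ => ?c) _ => apply continuous_const
  | |- continuous (fun y => @?f y - @?g y) _ =>
      apply (continuous_Cplus f (fun y => - g y)); solve_continuous
  | |- continuous (fun y => @?f y + @?g y) _ => apply (continuous_Cplus f g); solve_continuous
  | |- continuous (fun y => - @?f y) _ => apply (continuous_Copp f); solve_continuous
  | |- continuous (fun y => @?f y * @?g y) _ => apply (continuous_Cmult f g); solve_continuous
  | |- continuous (fun y => (@?f y) ^ 2) _ =>
      apply (continuous_Cmult f (fun y => f y * 1)); solve_continuous
  | |- _ => assumption
  end.

(** * Conservation of the first integrals *)

Lemma is_deriv_zero_const (a b : Rbar) (f : R -> C) :
  (forall t : R, Rbar_lt a t -> Rbar_lt t b -> is_deriv f t 0) ->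
  forall t u : R, Rbar_lt a t /\ Rbar_lt t b -> Rbar_lt a u /\ Rbar_lt u b ->
  f t = f u.
Proof.
  intros Hf.
  assert (W : forall t u : R, Rbar_lt a t -> Rbar_lt u b -> (t < u)%R -> f t = f u).
  { intros t u Ha Hb Htu.
    apply (eq_is_derive (V := C_R_NormedModule)); [|exact Htu].
    intros v [H1 H2]. apply Hf.
    - now apply Rbar_lt_le_trans with t.
    - now apply Rbar_le_lt_trans with u. }
  intros t u [Ha Hb] [Ha' Hb'].
  destruct (Rtotal_order t u) as [H|[->|H]]; [|reflexivity|symmetry]; now apply W.
Qed.

(** Each of the four relations is the vanishing of a function whose derivative along the system is
    zero. This carries the level condition from the single time [t0] to every time of the
    interval. *)
Lemma on_level_conserved (a b : Rbar) (p q r gam1 gam2 gam3 : R -> C) (h g2 g3 k : C) :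
  is_solution a b p q r gam1 gam2 gam3 ->
  forall t u : R, Rbar_lt a t /\ Rbar_lt t b -> Rbar_lt a u /\ Rbar_lt u b ->
  on_level h g2 g3 k (p t) (q t) (r t) (gam1 t) (gam2 t) (gam3 t) ->
  on_level h g2 g3 k (p u) (q u) (r u) (gam1 u) (gam2 u) (gam3 u).
Proof.
  intros Hsol t u Ht Hu.
  pose (x1 y := p y + q y). pose (x2 y := p y - q y).
  pose (e1 y := x1 y ^ 2 + gam1 y + gam2 y). pose (e2 y := x2 y ^ 2 + gam1 y - gam2 y).
  (* In these variables e1' = -2 r e1 and e2' = 2 r e2, which makes the product [e1 * e2] constant
     at once. *)
  assert (Hx : forall y : R, Rbar_lt a y -> Rbar_lt y b ->
    is_deriv x1 y (- (r y * x1 y) - gam3 y) /\ is_deriv x2 y (r y * x2 y + gam3 y) /\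
    is_deriv e1 y (- (2 * r y * e1 y)) /\ is_deriv e2 y (2 * r y * e2 y)).
  { intros y H1 H2. destruct (Hsol y H1 H2) as (Dp & Dq & Dr & D1 & D2 & D3).
    split; [|split; [|split]]; (eapply is_deriv_eq;
      [unfold e1, e2, x1, x2; solve_deriv|unfold e1, e2, x1, x2; cbv beta; ring]). }
  assert (I : forall f : R -> C,
    (forall y : R, Rbar_lt a y -> Rbar_lt y b -> is_deriv f y 0) -> f t = 0 -> f u = 0).
  { intros f Hf <-. symmetry. now apply (is_deriv_zero_const a b). }
  assert (Hsub : forall z w : C, z = w <-> z - w = 0).
  { intros z w; split; [intros ->; ring|]. intros E.
    replace z with (z - w + w) by ring. rewrite E. ring. }
  intros (E1 & E2 & E3 & E4). apply Hsub in E1, E2, E3, E4.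
  split; [|split; [|split]]; apply Hsub.
  - revert E1.
    apply (I (fun y => r y ^ 2 - (2 * (x1 y + x2 y) + e1 y + e2 y + h))).
    intros y H1 H2. destruct (Hsol y H1 H2) as (Dp & Dq & Dr & D1 & D2 & D3).
    destruct (Hx y H1 H2) as (X1 & X2 & Y1 & Y2).
    eapply is_deriv_eq; [solve_deriv|unfold e1, e2, x1, x2; cbv beta; ring].
  - revert E2.
    apply (I (fun y => r y * gam3 y - (- (x1 y * x2 y) - x2 y * e1 y - x1 y * e2 y - g2 / 4))).
    intros y H1 H2. destruct (Hsol y H1 H2) as (Dp & Dq & Dr & D1 & D2 & D3).
    destruct (Hx y H1 H2) as (X1 & X2 & Y1 & Y2).
    eapply is_deriv_eq; [solve_deriv|unfold e1, e2, x1, x2; cbv beta; ring].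
  - revert E3.
    apply (I (fun y => gam3 y ^ 2 - (x2 y ^ 2 * e1 y + x1 y ^ 2 * e2 y - g3 / 2))).
    intros y H1 H2. destruct (Hsol y H1 H2) as (Dp & Dq & Dr & D1 & D2 & D3).
    destruct (Hx y H1 H2) as (X1 & X2 & Y1 & Y2).
    eapply is_deriv_eq; [solve_deriv|unfold e1, e2, x1, x2; cbv beta; ring].
  - revert E4.
    apply (I (fun y => e1 y * e2 y - k ^ 2)).
    intros y H1 H2. destruct (Hx y H1 H2) as (X1 & X2 & Y1 & Y2).
    eapply is_deriv_eq; [solve_deriv|ring].
Qed.

(** * Derivatives of the roots of [polyF] *)

(** Vieta's relation for the sum of the roots, obtained by subtracting the two equations and
    cancelling [s1 - s2]. The left side is the partial derivative of [polyF] in [s] at [s1]. *)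
Lemma polyF_root_sum (g2 g3 x1 x2 s1 s2 : C) :
  polyF g2 g3 x1 x2 s1 = 0 -> polyF g2 g3 x1 x2 s2 = 0 -> s1 <> s2 ->
  2 * (x1 - x2) ^ 2 * s1 + (- (2 * x1 * x2 * (x1 + x2)) + g2 / 2 * (x1 + x2) + g3)
  = (x1 - x2) ^ 2 * (s1 - s2).
Proof.
  intros E1 E2 Hne.
  set (L := 2 * _ * s1 + _). set (M := (x1 - x2) ^ 2 * _).
  assert (Hd : s1 - s2 <> 0) by now apply Cminus_eq_contra.
  assert (E : (s1 - s2) * (L - M) = 0).
  { transitivity (polyF g2 g3 x1 x2 s1 - polyF g2 g3 x1 x2 s2).
    - unfold L, M, polyF. ring.
    - rewrite E1, E2. ring. }
  assert (E' : L - M = 0).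
  { transitivity (/ (s1 - s2) * ((s1 - s2) * (L - M))); [field; exact Hd|]. rewrite E; ring. }
  replace L with (L - M + M) by ring. rewrite E'. ring.
Qed.

(** Implicit differentiation of F = 0, with the denominator F_s rewritten by [polyF_root_sum]. It
    serves both roots, by exchanging [s1] and [s2]. *)
Lemma polyF_root_deriv (g2 g3 : C) (x1 x2 s1 s2 : R -> C) (t : R) (dx1 dx2 : C) :
  is_deriv x1 t dx1 -> is_deriv x2 t dx2 -> continuous s1 t ->
  locally t (fun y => polyF g2 g3 (x1 y) (x2 y) (s1 y) = 0) ->
  polyF g2 g3 (x1 t) (x2 t) (s2 t) = 0 -> x1 t - x2 t <> 0 -> s1 t - s2 t <> 0 ->
  is_deriv s1 t (- polyF_deriv g2 g3 (x1 t) (x2 t) dx1 dx2 (s1 t)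
                 / ((x1 t - x2 t) ^ 2 * (s1 t - s2 t))).
Proof.
  intros Hx1 Hx2 Cs E1 E2 Hx Hs.
  assert (Hne : s1 t <> s2 t) by (intros E; apply Hs; rewrite E; ring).
  pose proof (polyF_root_sum _ _ _ _ _ _ (locally_singleton _ _ E1) E2 Hne) as ES.
  rewrite <- ES.
  eapply is_deriv_eq.
  - apply (is_deriv_quadratic_root (fun y => (x1 y - x2 y) ^ 2)
      (fun y => - (2 * x1 y * x2 y * (x1 y + x2 y)) + g2 / 2 * (x1 y + x2 y) + g3)
      (fun y => x1 y ^ 2 * x2 y ^ 2 + x1 y * x2 y * (g2 / 2) + g3 * (x1 y + x2 y) + g2 ^ 2 / 16));
      [solve_deriv..|exact Cs|exact E1|].
    rewrite ES. repeat apply Cmult_neq_0; auto. apply C1_nz.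
  - f_equal. f_equal. unfold polyF_deriv. ring.
Qed.

Lemma continuous_polyF_deriv (g2 g3 : C) (x1 x2 dx1 dx2 s : R -> C) (t : R) :
  continuous x1 t -> continuous x2 t -> continuous dx1 t -> continuous dx2 t ->
  continuous s t ->
  continuous (fun y => polyF_deriv g2 g3 (x1 y) (x2 y) (dx1 y) (dx2 y) (s y)) t.
Proof.
  intros. unfold polyF_deriv. solve_continuous.
Qed.

(** * The quadratures along a solution *)

Theorem corollary1 (a b : Rbar) (p q r gam1 gam2 gam3 : R -> C)
    (g2 g3 k : C) (t0 : R) (D : R -> Prop) (s1 s2 : R -> C)
    (Hsol : is_solution a b p q r gam1 gam2 gam3)
    (Ht0 : Rbar_lt a t0 /\ Rbar_lt t0 b)
    (Hlevel : on_level 0 g2 g3 k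
                (p t0) (q t0) (r t0) (gam1 t0) (gam2 t0) (gam3 t0))
    (HDopen : open D)
    (HD : forall t : R, D t -> Rbar_lt a t /\ Rbar_lt t b)
    (Hroots : root_branches D g2 g3 k
                (fun t => p t + q t) (fun t => p t - q t) s1 s2) :
  satisfies_quadratures D g2 g3 k s1 s2.
Proof.
  pose (x1 t := p t + q t). pose (x2 t := p t - q t).
  pose (dx1 t := - (r t * x1 t) - gam3 t). pose (dx2 t := r t * x2 t + gam3 t).
  pose (N s t := polyF_deriv g2 g3 (x1 t) (x2 t) (dx1 t) (dx2 t) (s t)).
  (* The factor [s1 t - s2 t] changes sign between the two derivatives, while both square roots have
     the same denominator; hence the two quotients are opposite. *)
  exists (fun t => - N s1 t / ((x1 t - x2 t) ^ 2 * (s1 t - s2 t))).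
  exists (fun t => - N s2 t / ((x1 t - x2 t) ^ 2 * (s2 t - s1 t))).
  exists (fun t => - N s1 t / (2 * (x1 t - x2 t) ^ 2)).
  exists (fun t => - N s2 t / (2 * (x1 t - x2 t) ^ 2)).
  intros t Dt.
  destruct (HD t Dt) as [Hat Htb].
  destruct (Hsol t Hat Htb) as (Dp & Dq & Dr & D1 & D2 & D3).
  destruct (Hroots t Dt) as (C1 & C2 & F1 & F2 & Nx & Ns & NPhi1 & NPhi2).
  assert (Nx' : x1 t - x2 t <> 0) by now apply Cminus_eq_contra.
  assert (Ns12 : s1 t - s2 t <> 0) by now apply Cminus_eq_contra.
  assert (Ns21 : s2 t - s1 t <> 0) by now apply Cminus_eq_contra, not_eq_sym.
  assert (H2 : (2 : C) <> 0) by (intros E; apply RtoC_inj in E; lra).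
  assert (Dx1 : is_deriv x1 t (dx1 t)).
  { eapply is_deriv_eq; [unfold x1; solve_deriv|unfold dx1, x1; ring]. }
  assert (Dx2 : is_deriv x2 t (dx2 t)).
  { eapply is_deriv_eq; [unfold x2; solve_deriv|unfold dx2, x2; ring]. }
  (* Implicit differentiation needs the root equation on a neighbourhood of [t], which openness of
     [D] supplies. *)
  assert (HF : forall s : R -> C,
    (forall u, D u -> polyF g2 g3 (x1 u) (x2 u) (s u) = 0) ->
    locally t (fun u => polyF g2 g3 (x1 u) (x2 u) (s u) = 0)).
  { intros s Hs. generalize (HDopen t Dt). apply filter_imp. exact Hs. }
  assert (HN : forall s : R -> C, polyF g2 g3 (x1 t) (x2 t) (s t) = 0 ->
    N s t ^ 2 = 4 * (x1 t - x2 t) ^ 4 * polyPhi g2 g3 k (s t)).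
  { intros s Hs.
    destruct (on_level_conserved _ _ _ _ _ _ _ _ _ _ _ _ Hsol _ _ Ht0 (HD t Dt) Hlevel)
      as (E1 & E2 & E3 & E4).
    eapply polyF_deriv_sqr; [|exact E2|exact E3|exact E4|exact Hs].
    rewrite E1. unfold x1, x2. ring. }
  assert (Hw : forall s : R -> C, polyF g2 g3 (x1 t) (x2 t) (s t) = 0 ->
    (- N s t / (2 * (x1 t - x2 t) ^ 2)) ^ 2 = polyPhi g2 g3 k (s t)).
  { intros s Hs. transitivity (N s t ^ 2 / (4 * (x1 t - x2 t) ^ 4)).
    - field; repeat split; assumption.
    - rewrite (HN s Hs). field; assumption. }
  (* A zero of [N] would be a zero of Phi(s) by [Hw]. Nonvanishing lets [N] cancel in the quotients
     ds_i / w_i. *)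
  assert (HN0 : forall s : R -> C, polyF g2 g3 (x1 t) (x2 t) (s t) = 0 ->
    polyPhi g2 g3 k (s t) <> 0 -> N s t <> 0).
  { intros s Hs HP E. apply HP. rewrite <- (Hw s Hs), E. field; repeat split; assumption. }
  assert (Cx1 : continuous x1 t) by (eapply is_deriv_continuous, Dx1).
  assert (Cx2 : continuous x2 t) by (eapply is_deriv_continuous, Dx2).
  assert (Cw : forall s : R -> C, continuous s t ->
    continuous (fun u => - N s u / (2 * (x1 u - x2 u) ^ 2)) t).
  { intros s Cs. apply is_deriv_continuous in Dr, D3.
    apply continuous_Cmult.
    - apply continuous_Copp, continuous_polyF_deriv; try assumption;
        [unfold dx1|unfold dx2]; solve_continuous.
    - apply continuous_Cinv; [solve_continuous|].
      apply Cmult_neq_0; [exact H2|]. simpl. repeat apply Cmult_neq_0; auto. apply C1_nz. }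
  specialize (HN0 s1 F1 NPhi1) as HN1. specialize (HN0 s2 F2 NPhi2) as HN2.
  split; [|split; [|split; [|split; [|split; [|split; [|split]]]]]].
  - apply polyF_root_deriv; try assumption. apply HF. intros u Du; apply (Hroots u Du).
  - apply polyF_root_deriv; try assumption. apply HF. intros u Du; apply (Hroots u Du).
  - now apply Cw.
  - now apply Cw.
  - now apply Hw.
  - now apply Hw.
  (* After this cancellation the two sums are 2/(s1 - s2) + 2/(s2 - s1) = 0 and 2 (s1 - s2)/(s1 -
     s2) = 2. *)
  - field; repeat split; assumption.
  - field; repeat split; assumption.
Qed.
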